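(* (Outage capacity in the transmit power limited regime.) When $Q\gg P_{\max}$, the asymptotic outage capacity of the secondary user with transmit antenna selection among $N$ antennas, at outage threshold $\epsilon$, is $$C^{\mathrm{TPLR}}_{\mathrm{out}}=a_N^{\mathrm{TPLR}}-b_N^{\mathrm{TPLR}}\log\log\left(\frac1\epsilon\right),$$ where, with $c_q=1-e^{-Q/(P_{\max}\overline h)}$, $$a_N^{\mathrm{TPLR}}=\log\left(1+\frac{P_{\max}\overline g}{\sigma^2}\,\mathcal W\!\left(\frac{N\,c_q\,e^{\frac{\sigma^2}{P_p\overline q}}}{P_p\overline q/\sigma^2}\right)-\frac{P_{\max}\overline g}{P_p\overline q}\right),$$ $$b_N^{\mathrm{TPLR}}=\log\left(1+\frac{P_{\max}\overline g}{\sigma^2}\,\mathcal W\!\left(\frac{e\,N\,c_q\,e^{\frac{\sigma^2}{P_p\overline q}}}{P_p\overline q/\sigma^2}\right)-\frac{P_{\max}\overline g}{P_p\overline q}\right)-a_N^{\mathrm{TPLR}}.$$ The outage capacity scales the same way as the mean capacity of the secondary user, i.e. $C^{\mathrm{TPLR}}_{\mathrm{out}}\sim\log\log(N)$ as $N\to\infty$, and asymptotically it does not depend on the outage threshold $\epsilon$.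
   Context: Logarithms are natural and $e$ is their base. $\mathcal W$ is the Lambert W-function, satisfying $\mathcal W(x)e^{\mathcal W(x)}=x$. The per-antenna SINR of the secondary user is $\gamma=\min\left\{\frac{Qg}{h(P_pq+\sigma^2)},\frac{P_{\max}g}{P_pq+\sigma^2}\right\}$, where $g,h,q$ are independent exponential random variables with means $\overline g,\overline h,\overline q$, and $Q$ (interference power constraint), $P_{\max}$ (maximum transmit power), $P_p$ (primary transmit power), $\sigma^2$ (noise power) are positive. With antenna selection among $N$ antennas, the per-antenna SINRs are treated as i.i.d. with distribution function $F_\gamma$, and the rate $R_{\max}$ is the maximum of the $N$ per-antenna rates $\log(1+\gamma)$; the mean capacity is $\mathbb E[R_{\max}]$ and the outage capacity is the $\epsilon$-quantile of $R_{\max}$, $\epsilon\in(0,1)$. By extreme value theory the distribution of $R_{\max}$ is approximated for large $N$ by the Gumbel distribution $\exp\left(-e^{-(x-a_N)/b_N}\right)$ with $a_N=\log[1+F_\gamma^{-1}(1-\frac1N)]$ and $b_N=\log\frac{1+F_\gamma^{-1}(1-\frac1{Ne})}{1+F_\gamma^{-1}(1-\frac1N)}$, so that the outage capacity is approximated by $a_N-b_N\log\log(1/\epsilon)$. The asymptotic outage capacity $C^{\mathrm{TPLR}}_{\mathrm{out}}$ is the value of this approximation when, in the regime $Q\gg P_{\max}$, $F_\gamma$ is replaced by its asymptotic form $F(x)=1-\frac{c_q\,P_{\max}\overline g}{xP_p\overline q+P_{\max}\overline g}\,e^{-\frac{x\sigma^2}{P_{\max}\overline g}}$. *)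

(* Defs.v *)
From HB Require Import structures.
From mathcomp Require Import all_boot all_order all_algebra.
From mathcomp Require Import all_classical all_reals all_analysis.

Set Implicit Arguments.
Unset Strict Implicit.
Unset Printing Implicit Defensive.

Import Order.TTheory GRing.Theory Num.Theory.
Import numFieldNormedType.Exports.

Local Open Scope classical_set_scope.
Local Open Scope ring_scope.

(* The principal branch: w e^w is injective on [-1, +oo[, with range
   [-1/e, +oo[. *)
Definition lambertW (R : realType) (x : R) : R :=
  xget 0 [set w | -1 <= w /\ w * expR w = x].

Definition quantile (R : realType) (F : R -> R) (p : R) : R :=
  inf [set x | p <= F x].

Definition gumbel_cdf (R : realType) (a b x : R) : R :=
  expR (- expR (- ((x - a) / b))).

(* Equality is only required on measurable sets: [exponential_prob] is an
   integral, which has no meaning on the others. *)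
Definition exponential_RV d (T : measurableType d) (R : realType)
    (P : probability T R) (mean : R) (X : {RV P >-> R}) : Prop :=
  forall A, measurable A -> distribution P X A = exponential_prob mean^-1 A.

Definition independent_RVs d (T : measurableType d) (R : realType)
    (P : probability T R) (I : eqType) (X : I -> {RV P >-> R}) : Prop :=
  forall (s : seq I) (B : I -> set R),
    uniq s -> (forall i, measurable (B i)) ->
    P (\bigcap_(i in [set` s]) (X i @^-1` B i)) =
    (\prod_(i <- s) P (X i @^-1` B i))%E.

Record system (R : realType) := System {
  Q : R;       (* interference power constraint *)
  Pmax : R;    (* maximum transmit power *)
  Pp : R;      (* primary transmit power *)
  sigma2 : R;  (* noise power *)
  gbar : R;    (* means of the channel gains g, h, q *)
  hbar : R;
  qbar : R;
  Q_gt0 : 0 < Q;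
  Pmax_gt0 : 0 < Pmax;
  Pp_gt0 : 0 < Pp;
  sigma2_gt0 : 0 < sigma2;
  gbar_gt0 : 0 < gbar;
  hbar_gt0 : 0 < hbar;
  qbar_gt0 : 0 < qbar }.

Definition sinr (R : realType) (S : system R) (g h q : R) : R :=
  Num.min (Q S * g / (h * (Pp S * q + sigma2 S)))
          (Pmax S * g / (Pp S * q + sigma2 S)).

Definition F_gamma d (T : measurableType d) (R : realType)
    (P : probability T R) (S : system R) (g h q : {RV P >-> R}) (x : R)
    : \bar R :=
  P [set w | sinr S (g w) (h w) (q w) <= x].

(* Maximal rate over antennas 0, ..., N - 1. Seeding the maximum with the rate
   of antenna 0 changes nothing when N > 0. *)
Definition R_max d (T : measurableType d) (R : realType)
    (P : probability T R) (gam : nat -> {RV P >-> R}) (N : nat) (w : T) : R :=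
  \big[Num.max/ln (1 + gam 0 w)]_(i < N) ln (1 + gam i w).

Definition mean_capacity d (T : measurableType d) (R : realType)
    (P : probability T R) (gam : nat -> {RV P >-> R}) (N : nat) : \bar R :=
  ('E_P[R_max gam N])%E.

Section gumbel_approximation.
Variables (R : realType) (Finv : R -> R) (N : nat).

Definition gumbel_a : R := ln (1 + Finv (1 - N%:R^-1)).

Definition gumbel_b : R :=
  ln ((1 + Finv (1 - (N%:R * expR 1)^-1)) / (1 + Finv (1 - N%:R^-1))).

Definition approx_outage_capacity (eps : R) : R :=
  quantile (gumbel_cdf gumbel_a gumbel_b) eps.

End gumbel_approximation.

Section transmit_power_limited_regime.
Variables (R : realType) (S : system R).

Definition c_q : R := 1 - expR (- (Q S / (Pmax S * hbar S))).

Definition F_TPLR (x : R) : R :=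
  1 - c_q * Pmax S * gbar S / (x * Pp S * qbar S + Pmax S * gbar S)
      * expR (- (x * sigma2 S / (Pmax S * gbar S))).

(* [F_TPLR] increases from -oo to 1 on the half-line where its denominator is
   positive; this is its inverse there. For p >= F_TPLR 0 = 1 - c_q it is the
   usual quantile at level p of the distribution function of a nonnegative
   variable given by [F_TPLR] on [0, +oo[. *)
Definition F_TPLR_inv : R -> R :=
  'pinv_(fun=> 0) `]- (Pmax S * gbar S / (Pp S * qbar S)), +oo[ F_TPLR.

Definition C_out_TPLR (N : nat) (eps : R) : R :=
  approx_outage_capacity F_TPLR_inv N eps.

Definition a_TPLR (N : nat) : R :=
  ln (1 + Pmax S * gbar S / sigma2 S
          * lambertW (N%:R * c_q * expR (sigma2 S / (Pp S * qbar S))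
                      / (Pp S * qbar S / sigma2 S))
        - Pmax S * gbar S / (Pp S * qbar S)).

Definition b_TPLR (N : nat) : R :=
  ln (1 + Pmax S * gbar S / sigma2 S
          * lambertW (expR 1 * N%:R * c_q * expR (sigma2 S / (Pp S * qbar S))
                      / (Pp S * qbar S / sigma2 S))
        - Pmax S * gbar S / (Pp S * qbar S))
  - a_TPLR N.

End transmit_power_limited_regime.

(* Main.v *)
(* Under the affine change of variable w = sigma2 x / (Pmax gbar) +
   sigma2 / (Pp qbar), the equation F(x) = 1 - 1/t becomes w e^w = t k for a
   constant k, so F^-1 is affine in W. Taking logarithms, W + ln W = ln; hence
   W(k N) is within constant factors of ln N, which makes a_N - ln ln N bounded,
   and W(e y) <= W(y) + 1, which makes b_N tend to 0.
   For the mean capacity no approximation is involved: for x > 0 the tail of the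
   SINR lies between p0 e^(- kap x) and e^(- lam x). Integrating the union
   bound on the tail of R_max gives E[R_max] <= ln (1 + ln N / lam) + 1 / lam,
   and Markov's inequality at the level ln (1 + ln N / (2 kap)), which R_max
   misses with probability O(1 / ln N), gives the matching lower bound. *)
Require Import Defs.
From HB Require Import structures.
From mathcomp Require Import all_boot all_order all_algebra.
From mathcomp Require Import all_classical all_reals all_analysis.
From mathcomp Require Import measurable_realfun.
From mathcomp Require Import ring lra.

Set Implicit Arguments.
Unset Strict Implicit.
Unset Printing Implicit Defensive.

Import Order.TTheory GRing.Theory Num.Theory.
Import numFieldNormedType.Exports.

Local Open Scope classical_set_scope.
Local Open Scope ring_scope.

(** * The Lambert function and the Gumbel approximation *)

Section lambertW.
Variable R : realType.
Implicit Types w x y : R.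

Lemma ltr_xexpR x y : 0 <= x -> x < y -> x * expR x < y * expR y.
Proof.
move=> x0 xy; apply: ltr_pM => //; rewrite ?expR_ge0 ?ltr_expR //.
Qed.

(** A competing solution [v] has the sign of [v * expR v], so it is positive, and strict
    monotonicity on the nonnegative half-line identifies it with [w]. *)
Lemma lambertWK w : 0 < w -> lambertW (w * expR w) = w.
Proof.
move=> w0; apply: xget_unique => [|v [_ vE]].
  by split => //; rewrite (le_trans _ (ltW w0)) // lerN10.
have v0 : 0 < v by rewrite -(pmulr_lgt0 v (expR_gt0 v)) vE mulr_gt0 ?expR_gt0.
case: (ltgtP v w) => // [vw|wv].
- by have := ltr_xexpR (ltW v0) vw; rewrite vE ltxx.
- by have := ltr_xexpR (ltW w0) wv; rewrite vE ltxx.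
Qed.

Lemma xexpR_surj y : 0 < y -> exists2 w, 0 < w & w * expR w = y.
Proof.
move=> y0.
have [||c + cE] := @IVT R (fun w => w * expR w) 0 y y (ltW y0).
- apply: continuous_subspaceT => x.
  by apply: continuousM => //; exact: continuous_expR.
- rewrite mul0r ge_min le_max (ltW y0) /= ler_pMr //.
  by rewrite -expR0 ler_expR (ltW y0) orbT.
rewrite in_itv/= => /andP[c0 _]; exists c => //.
rewrite lt_neqAle c0 andbT; apply/eqP => c00.
by move: y0; rewrite -cE -c00 mul0r ltxx.
Qed.

Lemma lambertW_gt0 y : 0 < y -> 0 < lambertW y.
Proof. by move=> /xexpR_surj[w w0 <-]; rewrite lambertWK. Qed.

Lemma lambertWE y : 0 < y -> lambertW y * expR (lambertW y) = y.
Proof. by move=> /xexpR_surj[w w0 <-]; rewrite lambertWK. Qed.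

Lemma lambertW_lnE y : 0 < y -> lambertW y + ln (lambertW y) = ln y.
Proof.
move=> y0; rewrite -[in RHS](lambertWE y0).
by rewrite lnM ?posrE ?expR_gt0 ?lambertW_gt0 // expRK addrC.
Qed.

Lemma lambertW_lt x y : 0 < x -> x < y -> lambertW x < lambertW y.
Proof.
move=> x0 xy; have y0 := lt_trans x0 xy.
rewrite ltNge; apply/negP; rewrite le_eqVlt => /orP[/eqP|] WW.
  by move: xy; rewrite -(lambertWE x0) -WW lambertWE // ltxx.
have := ltr_xexpR (ltW (lambertW_gt0 y0)) WW.
by rewrite !lambertWE // ltNge (ltW xy).
Qed.

(** Multiplying the argument by e adds exactly 1 to [W + ln W], and [ln W] does not decrease. *)
Lemma lambertW_expR1M y : 0 < y -> lambertW (expR 1 * y) <= lambertW y + 1.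
Proof.
move=> y0; have ey0 : 0 < expR 1 * y by rewrite mulr_gt0 ?expR_gt0.
have lty : y < expR 1 * y by rewrite ltr_pMl // -expR0 ltr_expR.
have := lambertW_lnE y0; have := lambertW_lnE ey0.
rewrite lnM ?posrE ?expR_gt0 // expRK.
have : ln (lambertW y) <= ln (lambertW (expR 1 * y)).
  by rewrite ler_ln ?posrE ?lambertW_gt0 // ltW // lambertW_lt.
lra.
Qed.

(** Here [ln y] lies between [l / 2] and [3 * l / 2]. Below, [ln y = W + ln W < 2 * W]. Above,
    either [W < 1 <= l], or [ln W >= 0] and then [W <= ln y]. *)
Lemma lambertW_bounds y l : 0 < y -> 1 <= l -> 2 * `|ln y - l| <= l ->
  l / 4 <= lambertW y <= 2 * l.
Proof.
move=> y0 l1 yl; have W0 := lambertW_gt0 y0; have := lambertW_lnE y0.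
have [yl1 yl2] : - (l / 2) <= ln y - l /\ ln y - l <= l / 2.
  by apply/andP; rewrite -ler_norml; lra.
have lnW : ln (lambertW y) < lambertW y by exact: ln_sublinear.
have [W1|W1] := leP 1 (lambertW y).
  have := ln_ge0 W1 => ? ?; apply/andP; split; lra.
move=> ?; apply/andP; split; lra.
Qed.

End lambertW.

Section gumbel.
Variable R : realType.

Lemma quantile_gumbel (a b eps : R) : 0 < b -> 0 < eps < 1 ->
  quantile (gumbel_cdf a b) eps = a - b * ln (ln (1 / eps)).
Proof.
move=> b0 /andP[e0 e1]; set z := _ - _.
have lne0 : 0 < ln (1 / eps) by rewrite ln_gt0 // div1r invf_gt1.
have epsE : eps = gumbel_cdf a b z.
  rewrite /gumbel_cdf (_ : (z - a) / b = - ln (ln (1 / eps))); last first.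
    by rewrite /z; field; rewrite gt_eqF.
  by rewrite opprK lnK ?posrE // div1r lnV ?posrE // opprK lnK ?posrE.
rewrite /quantile.
(* As [b > 0], the Gumbel function is strictly increasing, and it takes the value [eps] at [z]. *)
suff -> : [set x | eps <= gumbel_cdf a b x] = `[z, +oo[%classic.
  by rewrite inf_itv ?bnd_simp.
apply/seteqP; split => x /=; rewrite in_itv/= andbT epsE /gumbel_cdf;
  by rewrite ler_expR lerN2 ler_expR lerN2 ler_pM2r ?invr_gt0 // lerD2r.
Qed.

End gumbel.

(** * Comparison with ln ln N *)

Section asymptotics.
Variable R : realType.

Lemma near_ln_natr_ge (A : R) : \forall N \near \oo, A <= ln N%:R.
Proof.
near=> N; have AN : expR A <= N%:R by near: N; exact: nbhs_infty_ger.
by rewrite -(expRK A) ler_ln // posrE ?expR_gt0 // (lt_le_trans _ AN) ?expR_gt0.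
Unshelve. all: by end_near. Qed.

Lemma dist_ln_le (m M l x : R) : 0 < m -> 0 < l -> m * l <= x <= M * l ->
  `|ln x - ln l| <= `|ln m| + `|ln M|.
Proof.
move=> m0 l0 /andP[mx xM].
have x0 : 0 < x by rewrite (lt_le_trans _ mx) ?mulr_gt0.
have M0 : 0 < M by rewrite -(pmulr_lgt0 M l0) (lt_le_trans x0).
have : ln m + ln l <= ln x by rewrite -lnM ?posrE // ler_ln ?posrE ?mulr_gt0.
have : ln x <= ln M + ln l by rewrite -lnM ?posrE // ler_ln ?posrE ?mulr_gt0.
rewrite ler_norml; have := ler_norm (ln M); have := lerNnormlW (lexx `|ln m|).
have := normr_ge0 (ln m); have := normr_ge0 (ln M).
by move=> *; apply/andP; split; lra.
Qed.

Lemma equiv_lnln (f : nat -> R) (C : R) :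
  (\forall N \near \oo, `|f N - ln (ln N%:R)| <= C) ->
  (f : nat -> R^o) ~_\oo (fun N : nat => ln (ln N%:R) : R^o).
Proof.
move=> fC; apply/eqaddoP => e e0; near=> N.
have fNC : `|f N - ln (ln N%:R)| <= C by near: N.
(* Past this level [ln (ln N)] is at least [C / e], so the bounded error is at most [e] times it. *)
have lC : expR (C / e) <= ln N%:R by near: N; exact: near_ln_natr_ge.
apply: (le_trans fNC); rewrite -ler_pdivrMl // mulrC.
rewrite (le_trans _ (ler_norm _)) // -(expRK (C / e)) ler_ln ?posrE ?expR_gt0//.
by rewrite (lt_le_trans _ lC) ?expR_gt0.
Unshelve. all: by end_near. Qed.

End asymptotics.

(** * Closed form and asymptotics of the outage capacity *)

Section transmit_power_limited_regime.
Variables (R : realType) (S : system R).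

Let alpha := Pmax S * gbar S / sigma2 S.
Let beta := Pmax S * gbar S / (Pp S * qbar S).
Let kap := c_q S * expR (sigma2 S / (Pp S * qbar S)) / (Pp S * qbar S / sigma2 S).
Let W x := lambertW (x * kap).

Let pos := (Q_gt0 S, Pmax_gt0 S, Pp_gt0 S, sigma2_gt0 S, gbar_gt0 S,
  hbar_gt0 S, qbar_gt0 S).
Let neq0 := (gt_eqF (Pmax_gt0 S), gt_eqF (Pp_gt0 S), gt_eqF (sigma2_gt0 S),
  gt_eqF (gbar_gt0 S), gt_eqF (qbar_gt0 S)).

Let alpha_gt0 : 0 < alpha. Proof. by rewrite divr_gt0 ?mulr_gt0 ?pos. Qed.

Lemma c_q_gt0 : 0 < c_q S.
Proof.
by rewrite /c_q subr_gt0 -[ltRHS]expR0 ltr_expR oppr_lt0 divr_gt0 ?mulr_gt0 ?pos.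
Qed.

Let kap_gt0 : 0 < kap.
Proof. by rewrite !(mulr_gt0, divr_gt0, invr_gt0) ?expR_gt0 ?c_q_gt0 ?pos. Qed.

(** The substitution moves the pole [- beta] of [F_TPLR] to [w = 0]: the denominator becomes a
    multiple of [w] and the exponent becomes a constant minus [w]. *)
Let F_TPLRE (w : R) : w != 0 ->
  F_TPLR S (alpha * w - beta) = 1 - kap * (w * expR w)^-1.
Proof.
move=> w0; rewrite /F_TPLR.
have -> : - ((alpha * w - beta) * sigma2 S / (Pmax S * gbar S)) =
    sigma2 S / (Pp S * qbar S) - w.
  by rewrite /alpha /beta; field; rewrite !neq0.
have -> : (alpha * w - beta) * Pp S * qbar S + Pmax S * gbar S =
    alpha * w * Pp S * qbar S.
  by rewrite /alpha /beta; field; rewrite !neq0.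
rewrite expRD expRN /kap /alpha; field.
by rewrite !neq0 gt_eqF ?expR_gt0 // w0.
Qed.

Lemma F_TPLR_invE (t : R) : 0 < t ->
  F_TPLR_inv S (1 - t^-1) = alpha * W t - beta.
Proof.
move=> t0; have tk0 : 0 < t * kap by rewrite mulr_gt0.
have W0 : 0 < W t by exact: lambertW_gt0.
have <- : F_TPLR S (alpha * W t - beta) = 1 - t^-1.
  rewrite F_TPLRE ?gt_eqF // lambertWE // invfM mulrCA mulfV ?mulr1 //.
  by rewrite gt_eqF.
apply: pinvKV; last first.
  by rewrite inE/= in_itv/= andbT ltrDr mulr_gt0.
(* The partial inverse requires injectivity on the half-line. Its points are the [alpha * w - beta]
   with [w > 0], and [lambertWK] recovers [w] from [w * expR w]. *)
move=> x y; rewrite !inE/= !in_itv/= !andbT => x0 y0.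
have wE z : - beta < z -> exists2 w, 0 < w & z = alpha * w - beta.
  move=> z0; exists ((z + beta) / alpha).
    by rewrite divr_gt0 // -ltrBlDr sub0r.
  by rewrite mulrC divfK ?addrK // gt_eqF.
have [u u0 ->] := wE _ x0; have [v v0 ->] := wE _ y0.
rewrite !F_TPLRE ?gt_eqF // => /addrI/oppr_inj/(mulfI (negbT (gt_eqF kap_gt0))).
by move=> /invr_inj E; rewrite -(lambertWK u0) E lambertWK.
Qed.

Let D N := 1 + alpha * W N%:R - beta.

Let F_TPLR_inv_nat N : (0 < N)%N -> 1 + F_TPLR_inv S (1 - N%:R^-1) = D N.
Proof. by move=> N0; rewrite F_TPLR_invE ?ltr0n // /D addrA. Qed.

Let F_TPLR_inv_natM N : (0 < N)%N ->
  1 + F_TPLR_inv S (1 - (N%:R * expR 1)^-1) =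
  1 + alpha * W (N%:R * expR 1) - beta.
Proof. by move=> N0; rewrite F_TPLR_invE ?mulr_gt0 ?expR_gt0 ?ltr0n // addrA. Qed.

Lemma a_TPLRE N : a_TPLR S N = ln (D N).
Proof. by rewrite /a_TPLR /D /W /kap !mulrA. Qed.

Lemma b_TPLRE N :
  b_TPLR S N = ln (1 + alpha * W (N%:R * expR 1) - beta) - ln (D N).
Proof. by rewrite /b_TPLR a_TPLRE /W /kap (mulrC (N%:R)) !mulrA. Qed.

Lemma gumbel_a_TPLR N : (0 < N)%N -> gumbel_a (F_TPLR_inv S) N = a_TPLR S N.
Proof. by move=> N0; rewrite /gumbel_a F_TPLR_inv_nat // a_TPLRE. Qed.

Let W_lt N : (0 < N)%N -> W N%:R < W (N%:R * expR 1).
Proof.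
move=> N0; apply: lambertW_lt; first by rewrite mulr_gt0 ?ltr0n.
by rewrite ltr_pM2r // ltr_pMr ?ltr0n // -expR0 ltr_expR.
Qed.

Let W_le N : (0 < N)%N -> W (N%:R * expR 1) <= W N%:R + 1.
Proof.
move=> N0; rewrite /W (mulrC _ (expR 1)) -mulrA.
by apply: lambertW_expR1M; rewrite mulr_gt0 ?ltr0n.
Qed.

Section defined.
Variable N : nat.
Hypotheses (N0 : (0 < N)%N) (D0 : 0 < 1 + F_TPLR_inv S (1 - N%:R^-1)).

Let DN0 : 0 < D N. Proof. by rewrite -F_TPLR_inv_nat. Qed.

Let lt_D : D N < 1 + alpha * W (N%:R * expR 1) - beta.
Proof. by rewrite /D ltrD2r ltrD2l ltr_pM2l // W_lt. Qed.

(** The logarithm of the quotient splits because both terms are positive: the denominator by [D0],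
    the numerator because it is larger. *)
Lemma gumbel_b_TPLR : gumbel_b (F_TPLR_inv S) N = b_TPLR S N.
Proof.
rewrite /gumbel_b F_TPLR_inv_nat // F_TPLR_inv_natM // b_TPLRE.
by rewrite ln_div ?posrE // (lt_trans DN0).
Qed.

Lemma b_TPLR_gt0 : 0 < b_TPLR S N.
Proof. by rewrite b_TPLRE subr_gt0 ltr_ln ?posrE // (lt_trans DN0). Qed.

(** Apply [ln y <= y - 1] to the quotient [y] in [gumbel_b]; its numerator exceeds its denominator
    by [alpha] times an increment of [W] that is at most 1. *)
Lemma b_TPLR_le : b_TPLR S N <= alpha / (1 + F_TPLR_inv S (1 - N%:R^-1)).
Proof.
rewrite F_TPLR_inv_nat // b_TPLRE -ln_div ?posrE //; last exact: lt_trans lt_D.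
set y := _ / _; have {1}-> : y = 1 + (y - 1) by rewrite subrKC.
apply: le_trans (le_ln1Dx _) _.
  by rewrite ltrBrDl subrr divr_gt0 // (lt_trans DN0).
rewrite /y -[X in _ - X](divff (negbT (gt_eqF DN0))).
rewrite -mulrBl ler_pM2r ?invr_gt0 //.
have := ler_wpM2l (ltW alpha_gt0) (W_le N0); rewrite /D; lra.
Qed.

Lemma C_out_TPLRE (eps : R) : 0 < eps < 1 ->
  C_out_TPLR S N eps = a_TPLR S N - b_TPLR S N * ln (ln (1 / eps)).
Proof.
move=> e01; rewrite /C_out_TPLR /approx_outage_capacity.
by rewrite gumbel_a_TPLR // gumbel_b_TPLR quantile_gumbel ?b_TPLR_gt0.
Qed.

End defined.

Lemma F_TPLR_inv_bounds : exists m M : R, 0 < m /\ \forall N \near \oo,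
  m * ln N%:R <= 1 + F_TPLR_inv S (1 - N%:R^-1) <= M * ln N%:R.
Proof.
(* From [lambertW_bounds], [alpha * W] lies between [alpha / 4] and [2 * alpha] times [ln N]. Half
   of the lower slope is given up to absorb [1 - beta]; above, [ln N >= 1] absorbs it. *)
exists (alpha / 8), (2 * alpha + `|1 - beta|); split; first by rewrite divr_gt0.
near=> N.
have N0 : (0 < N)%N by near: N; exact: nbhs_infty_gt.
have l1 : 1 <= ln N%:R :> R by near: N; exact: near_ln_natr_ge.
(* This is the hypothesis of [lambertW_bounds] at [y = N * kap] and [l = ln N], where
   [ln y - l = ln kap]. *)
have l2 : 2 * `|ln kap| <= ln N%:R by near: N; exact: near_ln_natr_ge.
have l3 : `|1 - beta| / (alpha / 8) <= ln N%:R.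
  by near: N; exact: near_ln_natr_ge.
rewrite F_TPLR_inv_nat // /D -addrA (addrCA 1).
rewrite ler_pdivrMr in l3; last by rewrite divr_gt0.
have /andP[] : ln N%:R / 4 <= W N%:R <= 2 * ln N%:R.
  apply: lambertW_bounds => //; first by rewrite mulr_gt0 ?ltr0n.
  by rewrite lnM ?posrE ?ltr0n // addrAC subrr add0r.
move=> /(ler_wpM2l (ltW alpha_gt0)) + /(ler_wpM2l (ltW alpha_gt0)).
have := ler_norm (1 - beta); have := lerNnormlW (lexx `|1 - beta|).
have := ler_peMr (normr_ge0 (1 - beta)) l1.
by move=> *; apply/andP; split; lra.
Unshelve. all: by end_near. Qed.

Lemma near_F_TPLR_inv_gt0 : \forall N \near \oo, 0 < 1 + F_TPLR_inv S (1 - N%:R^-1).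
Proof.
have [m [M [m0 mM]]] := F_TPLR_inv_bounds; near=> N.
have /andP[+ _] : m * ln N%:R <= 1 + F_TPLR_inv S (1 - N%:R^-1) <= M * ln N%:R.
  by near: N.
apply: lt_le_trans; rewrite mulr_gt0 // (@lt_le_trans _ _ 1) //.
by near: N; exact: near_ln_natr_ge.
Unshelve. all: by end_near. Qed.

Lemma b_TPLR_cvg0 : b_TPLR S N @[N --> \oo] --> (0 : R).
Proof.
have [m [M [m0 mM]]] := F_TPLR_inv_bounds.
apply/cvgrPdist_le => e e0; near=> N.
have N0 : (0 < N)%N by near: N; exact: nbhs_infty_gt.
have D0 : 0 < 1 + F_TPLR_inv S (1 - N%:R^-1).
  by near: N; exact: near_F_TPLR_inv_gt0.
have /andP[Dm _] : m * ln N%:R <= 1 + F_TPLR_inv S (1 - N%:R^-1) <= M * ln N%:R.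
  by near: N.
rewrite sub0r normrN ger0_norm ?(ltW (b_TPLR_gt0 _ _)) //.
apply: le_trans (b_TPLR_le N0 D0) _; rewrite ler_pdivrMr //.
rewrite -ler_pdivrMl //; apply: le_trans Dm; rewrite -ler_pdivrMl //.
by near: N; exact: near_ln_natr_ge.
Unshelve. all: by end_near. Qed.

Lemma C_out_TPLR_equiv (eps : R) : 0 < eps < 1 ->
  (fun N : nat => C_out_TPLR S N eps : R^o)
    ~_\oo (fun N : nat => ln (ln N%:R) : R^o).
Proof.
move=> e01; have [m [M [m0 mM]]] := F_TPLR_inv_bounds.
(* The first two terms bound [a_N - ln (ln N)]; the last one bounds the threshold term once [b_N] is
   at most 1 in absolute value. *)
apply: (@equiv_lnln _ _ (`|ln m| + `|ln M| + `|ln (ln (1 / eps))|)); near=> N.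
have N0 : (0 < N)%N by near: N; exact: nbhs_infty_gt.
have D0 : 0 < 1 + F_TPLR_inv S (1 - N%:R^-1).
  by near: N; exact: near_F_TPLR_inv_gt0.
rewrite C_out_TPLRE // addrAC (le_trans (ler_normB _ _)) // lerD //.
  rewrite a_TPLRE -F_TPLR_inv_nat //; apply: dist_ln_le => //; last by near: N.
  by rewrite (@lt_le_trans _ _ 1) //; near: N; exact: near_ln_natr_ge.
rewrite normrM ler_piMl //; near: N.
have /cvgrPdist_le/(_ 1 ltr01) := b_TPLR_cvg0.
by apply: filterS => N; rewrite sub0r normrN.
Unshelve. all: by end_near. Qed.

Lemma C_out_TPLR_threshold (eps1 eps2 : R) : 0 < eps1 < 1 -> 0 < eps2 < 1 ->
  C_out_TPLR S N eps1 - C_out_TPLR S N eps2 @[N --> \oo] --> (0 : R).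
Proof.
move=> e1 e2.
(* In the difference of the two capacities [a_N] cancels, leaving [b_N] times a constant. *)
have : b_TPLR S N * (ln (ln (1 / eps2)) - ln (ln (1 / eps1))) @[N --> \oo] -->
    (0 * (ln (ln (1 / eps2)) - ln (ln (1 / eps1))) : R).
  by apply: cvgM; [exact: b_TPLR_cvg0|exact: cvg_cst].
rewrite mul0r; apply: cvg_trans; apply: near_eq_cvg; near=> N.
have N0 : (0 < N)%N by near: N; exact: nbhs_infty_gt.
have D0 : 0 < 1 + F_TPLR_inv S (1 - N%:R^-1).
  by near: N; exact: near_F_TPLR_inv_gt0.
by rewrite !C_out_TPLRE //; ring.
Unshelve. all: by end_near. Qed.

End transmit_power_limited_regime.

(** * Extremes of i.i.d. rates *)

Lemma le_probability d (T : measurableType d) (R : realType)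
    (P : probability T R) (A B : set T) :
  measurable A -> measurable B -> A `<=` B -> (P A <= P B)%E.
Proof. by move=> mA mB; apply: le_measure; rewrite inE. Qed.

Lemma integral_expR_tail (R : realType) (lam r0 : R) : 0 < lam ->
  (\int[lebesgue_measure]_(r in `[r0, +oo[) (expR (- (lam * (r - r0))))%:E =
   (lam^-1)%:E)%E.
Proof.
move=> lam_gt0.
have cF : continuous (fun r : R => expR (- (lam * (r - r0)))).
  move=> r; apply: continuous_comp; last exact: continuous_expR.
  apply: continuousN; apply: continuousM; first exact: cst_continuous.
  by apply: continuousB => //; exact: cst_continuous.
have dF (r : R) : is_derive r 1 (fun r : R => - (lam^-1 * expR (- (lam * (r - r0)))))
    (expR (- (lam * (r - r0)))).
  apply: is_derive_eq.
  rewrite /GRing.scale /=; field; by rewrite gt_eqF.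
rewrite (@ge0_continuous_FTC2y _ _
  (fun r => - (lam^-1 * expR (- (lam * (r - r0))))) _ 0).
- by rewrite subrr mulr0 oppr0 expR0 mulr1 EFinN oppeK add0e.
- by move=> r _; exact: expR_ge0.
- exact: continuous_subspaceT.
- rewrite -oppr0; apply: cvgN; rewrite -(mulr0 lam^-1); apply: cvgMr.
  apply: (@cvg_comp _ _ _ (fun r : R => lam * (r - r0)) (fun r => expR (- r))
    _ (pinfty_nbhs R)); last exact: cvgr_expR.
  apply/cvgryPge => A; near=> r.
  rewrite -ler_pdivrMl // lerBrDr.
  by near: r; apply: nbhs_pinfty_ge; exact: num_real.
- by move=> r _; exact: (@ex_derive _ _ _ _ _ _ _ (dF r)).
- apply: cvg_at_right_filter; apply: cvgN; apply: cvgMr; exact: cF.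
- by move=> r _; rewrite derive1E (@derive_val _ _ _ _ _ _ _ (dF r)).
Unshelve. all: by end_near. Qed.

(** The expectation is the integral of the tail: below [r0] the tail is at most 1, above it the
    exponential integrates to [lam^-1]. *)
Lemma ge0_expectation_tail_le d (T : measurableType d) (R : realType)
    (P : probability T R) (Y : {RV P >-> R}) (lam r0 : R) :
  0 < lam -> 0 <= r0 -> (forall w, 0 <= Y w) ->
  (forall r, r0 <= r -> (ccdf Y r <= (expR (- (lam * (r - r0))))%:E)%E) ->
  ('E_P[Y] <= (r0 + lam^-1)%:E)%E.
Proof.
move=> lam_gt0 r00 Y0 Ytail; rewrite ge0_expectation_ccdf //.
rewrite (@itv_bndbnd_setU _ _ _ (BLeft r0)) ?bnd_simp //.
have mc D : measurable_fun D (ccdf Y).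
  by apply: measurable_funTS; exact: ccdf_measurable.
rewrite ge0_integral_setU //=; last 2 first.
- exact: mc.
- apply/disj_setPS => x [/=]; rewrite !in_itv/= andbT => /andP[_ xr].
  by rewrite leNgt xr.
rewrite EFinD; apply: leeD.
  apply: (@le_trans _ _ (\int[lebesgue_measure]_(r in `[0%R, r0[) (cst 1 r))%E).
    by apply: ge0_le_integral => //= [|r _]; [exact: mc|exact: probability_le1].
  rewrite integral_cst //= mul1e lebesgue_measure_itv /= lte_fin.
  by rewrite oppr0 adde0; case: ifP => _; rewrite lee_fin.
rewrite -(integral_expR_tail r0 lam_gt0); apply: ge0_le_integral => //=.
- exact: mc.
- apply/measurable_EFinP; apply: measurableT_comp => //.
  apply: measurableT_comp => //; apply: measurable_funM => //.
  exact: measurable_funB.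
- by move=> r; rewrite in_itv/= andbT; exact: Ytail.
Qed.

Section max_rate.
Context d (T : measurableType d) (R : realType) (P : probability T R).
Variable gam : nat -> {RV P >-> R}.
Implicit Types (N : nat) (w : T).

Lemma measurable_R_max N : measurable_fun [set: T] (R_max gam N).
Proof.
have mrate i : measurable_fun [set: T] (fun w => ln (1 + gam i w)).
  apply: measurableT_comp => //; exact: measurable_funD.
suff mmax (s : seq 'I_N) : measurable_fun [set: T]
    (fun w => \big[Num.max/ln (1 + gam 0 w)]_(i <- s) ln (1 + gam i w)).
  exact: mmax.
elim: s => [|i s IHs].
  by apply: eq_measurable_fun (mrate 0%N) => w _; rewrite big_nil.
apply: eq_measurable_fun (measurable_maxr (mrate i) IHs) => w _.
by rewrite big_cons.
Qed.

HB.instance Definition _ N :=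
  isMeasurableFun.Build _ _ _ _ (R_max gam N) (measurable_R_max N).

Hypothesis gam_lt0 : P (gam 0 @^-1` `]-oo, 0[) = 0%E.

(** The maximum is seeded with the rate of antenna 0, which is almost surely nonnegative. The
    positive part is nonnegative everywhere, as the tail formula requires. *)
Lemma mean_capacity_funrpos N : mean_capacity gam N = ('E_P[(R_max gam N)^\+])%E.
Proof.
rewrite /mean_capacity unlock; apply: ae_eq_integral => //.
- by apply/measurable_EFinP; exact: measurable_R_max.
- by apply/measurable_EFinP; apply: measurable_funrpos; exact: measurable_R_max.
exists (gam 0 @^-1` `]-oo, 0[); split => //; first exact: measurable_funPTI.
move=> w /= /not_implyP[_]; rewrite in_itv/= => + ; apply: contra_notT.
rewrite -leNgt => gw0; rewrite /funrpos max_l //.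
by apply: le_trans (bigmax_ge_id _ _ _ _); rewrite ln_ge0 // lerDl.
Qed.

Lemma mean_capacity_ge0 N : (0 <= mean_capacity gam N)%E.
Proof.
by rewrite mean_capacity_funrpos; apply: expectation_ge0 => w; exact: funrpos_ge0.
Qed.

Section upper_bound.
Variable lam : R.
Hypothesis lam_gt0 : 0 < lam.
Hypothesis gam_tail : forall (i : nat) (x : R), 0 <= x ->
  (ccdf (gam i) x <= (expR (- (lam * x)))%:E)%E.

Lemma ccdf_R_max_le N (r : R) : (0 < N)%N -> 0 <= r ->
  (ccdf ((R_max gam N)^\+ : {RV P >-> R})%R r <=
   (N%:R * expR (- (lam * (expR r - 1))))%:E)%E.
Proof.
move=> N0 r0; have x0 : 0 <= expR r - 1 by rewrite subr_ge0 -expR0 ler_expR.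
pose A i := gam i @^-1` `]expR r - 1, +oo[.
rewrite -[leLHS]/(P ((R_max gam N)^\+%R @^-1` `]r, +oo[)).
have mA i : measurable (A i) by exact: measurable_funPTI.
apply: (@le_trans _ _ (P (\big[setU/set0]_(i < N) A i))).
  apply: le_probability; first exact: measurable_funPTI.
    exact: bigsetU_measurable.
  move=> w /=; rewrite in_itv/= andbT /funrpos lt_max => /orP[|]; last first.
    by rewrite ltNge r0.
  suff rateP (i : 'I_N) : r < ln (1 + gam i w) ->
      (\big[setU/set0]_(j < N) A j) w.
    (* The seed of the maximum is itself the rate of antenna 0, one of the [N] antennas since
       [N > 0]. *)
    by case/bigmax_gtP => [|[i _]]; [exact: (rateP (Ordinal N0))|exact: rateP].
  move=> rw; rewrite -bigcup_mkord; exists (val i) => //=.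
  rewrite /A /= in_itv/= andbT ltrBlDl.
  (* Since [ln] is 0 on nonpositive reals, a rate above [r >= 0] excludes them. *)
  have g0 : 0 < 1 + gam i w.
    by rewrite ltNge; apply/negP => /ln0 g0; move: rw; rewrite g0 ltNge r0.
  by rewrite -(lnK g0) ltr_expR.
apply: le_trans (Boole_inequality _ _) _ => //.
apply: (@le_trans _ _ (\sum_(i < N) (expR (- (lam * (expR r - 1))))%:E)%E).
  by apply: lee_sum => i _; exact: gam_tail.
by rewrite sumEFin lee_fin sumr_const card_ord mulr_natl.
Qed.

(** The cut [r0] is the point where the union bound [N * expR (- (lam * (expR r - 1)))] equals 1;
    beyond it the bound decays at rate at least [lam]. *)
Lemma mean_capacity_le N : (0 < N)%N ->
  (mean_capacity gam N <= (ln (1 + ln N%:R / lam) + lam^-1)%:E)%E.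
Proof.
move=> N0; rewrite mean_capacity_funrpos; set L := ln N%:R; set r0 := ln _.
have L0 : 0 <= L by rewrite ln_ge0 // ler1n.
have y1 : 1 <= 1 + L / lam by rewrite lerDl divr_ge0 // ltW.
have r00 : 0 <= r0 by exact: ln_ge0.
apply: ge0_expectation_tail_le => // [w|r rr0]; first exact: funrpos_ge0.
apply: le_trans (ccdf_R_max_le N0 (le_trans r00 rr0)) _.
rewrite lee_fin -(@lnK _ N%:R) ?posrE ?ltr0n // -/L -expRD ler_expR.
have -> : expR r = (1 + L / lam) * expR (r - r0).
  by rewrite expRB lnK ?posrE ?(lt_le_trans _ y1) // mulrC divfK // gt_eqF // (lt_le_trans _ y1).
(* The aim is [lam * (expR r - 1) >= L + lam * (r - r0)]: expand the product and drop the
   nonnegative term [L / lam * (r - r0)]. *)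
have := expR_ge1Dx (r - r0) => e1.
have : (1 + L / lam) * (1 + (r - r0)) <= (1 + L / lam) * expR (r - r0).
  by rewrite ler_wpM2l // (le_trans _ y1).
have : 0 <= (L / lam) * (r - r0).
  by rewrite mulr_ge0 ?subr_ge0 // divr_ge0 // ltW.
set u := _ * expR _ => h1 h2.
have /(ler_wpM2l (ltW lam_gt0)) : 1 + L / lam + (r - r0) <= u by lra.
have -> : lam * (1 + L / lam + (r - r0)) = lam + L + lam * (r - r0).
  by field; rewrite gt_eqF.
lra.
Qed.

End upper_bound.

Section lower_bound.
Variables (kap p0 : R).
Hypotheses (kap_gt0 : 0 < kap) (p0_gt0 : 0 < p0).
Hypothesis gam_tail : forall (i : nat) (x : R), 0 < x ->
  ((p0 * expR (- (kap * x)))%:E <= ccdf (gam i) x)%E.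
Hypothesis gam_indep : independent_RVs gam.

(** By independence the probability is a product, and each factor is at most [1 - p <= expR (- p)],
    with [p] the lower bound on the tail. *)
Lemma probability_all_le N (x : R) : 0 < x ->
  (P (\bigcap_(i in [set` iota 0 N]) (gam i @^-1` `]-oo, x])) <=
   (expR (- (N%:R * (p0 * expR (- (kap * x))))))%:E)%E.
Proof.
move=> x0; rewrite (gam_indep (B := fun=> `]-oo, x]%classic)) ?iota_uniq //.
rewrite -mulrN expRM_natl -{2}(size_iota 0 N).
elim: (iota 0 N) => [|i s IHs]; first by rewrite big_nil.
rewrite big_cons /= exprS EFinM; apply: lee_pmul => //.
  by apply: prode_ge0 => j _.
rewrite -[leLHS]/(cdf (gam i) x) cdf_1_ccdf.
apply: (@le_trans _ _ (1 - (p0 * expR (- (kap * x)))%:E)%E).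
  by rewrite leeB // gam_tail.
by rewrite -EFinB lee_fin expR_ge1Dx.
Qed.

Lemma mean_capacity_ge N : (0 < N)%N -> 1 <= ln N%:R :> R ->
  ((ln (1 + ln N%:R / (2 * kap)) - (kap * p0)^-1)%:E <= mean_capacity gam N)%E.
Proof.
move=> N0; rewrite mean_capacity_funrpos; set L := ln N%:R => L1.
have L0 : 0 < L by exact: lt_le_trans L1.
set x := L / (2 * kap); have x0 : 0 < x by rewrite divr_gt0 // mulr_gt0.
have r0 : 0 < ln (1 + x) by rewrite ln_gt0 // ltrDl.
set r := ln (1 + x); pose C := \bigcap_(i in [set` iota 0 N]) (gam i @^-1` `]-oo, x]).
set Y : {RV P >-> R} := (R_max gam N)^\+%R.
have mC : measurable C.
  by apply: bigcap_measurableType => i _; exact: measurable_funPTI.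
(* At this [x], [N * expR (- (kap * x))] is the square root of [N], that is [expR (L / 2) >= L / 2];
   then [expR (- u) <= u^-1] is enough. *)
have PC : (P C <= (2 / (p0 * L))%:E)%E.
  apply: (le_trans (probability_all_le N x0)); rewrite lee_fin.
  have -> : N%:R * (p0 * expR (- (kap * x))) = p0 * expR (L / 2).
    rewrite -(@lnK _ N%:R) ?posrE ?ltr0n // -/L mulrCA -expRD; congr (_ * expR _).
    by rewrite /x; field; rewrite gt_eqF.
  rewrite expRN -[leRHS]invrK lef_pV2 ?posrE ?expR_gt0 ?invr_gt0 ?divr_gt0 ?mulr_gt0 //.
  have := expR_ge1Dx (L / 2); have := expR_ge1Dx (p0 * expR (L / 2)).
  rewrite invf_div => h1 h2.
  have h3 : L / 2 <= expR (L / 2) by rewrite (le_trans _ h2) // lerDr.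
  by apply: le_trans h1; rewrite -mulrA ler_wpDl // ler_wpM2l // ltW.
have CY : ~` C `<=` [set w | (r%:E <= `|(Y w)%:E|)%E].
  move=> w /existsNP[i] /not_implyP[/= iN]; rewrite in_itv/= => /negP.
  rewrite -ltNge => xg; rewrite ger0_norm ?funrpos_ge0 // lee_fin.
  rewrite /Y /= /funrpos le_max; apply/orP; left.
  move: iN; rewrite mem_iota add0n => /= iN.
  apply: (bigmax_sup (Ordinal iN)) => //=.
  have ? : 0 < 1 + x by rewrite addr_gt0.
  by rewrite ler_ln ?posrE ?lerD2l ?(ltW xg) // addr_gt0 // (lt_trans x0).
have := @markov _ _ _ P Y idfun r r0 (@measurable_id _ _ _) (fun _ => id)
  (fun _ _ _ _ => id).
rewrite (_ : _ \o Y = Y); last first.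
  by apply/funext => w /=; rewrite ger0_norm // funrpos_ge0.
apply: le_trans; apply: (@le_trans _ _ (r%:E * P (~` C))%E); last first.
  rewrite lee_pmul2l ?lte_fin //; apply: le_probability => //; first exact: measurableC.
  rewrite [X in measurable X](_ : _ = Y @^-1` `[r, +oo[%classic).
    exact: measurable_funPTI.
  apply/seteqP; split => w /=; rewrite in_itv/= andbT lee_fin ger0_norm //;
    exact: funrpos_ge0.
rewrite probability_setC //.
apply: (@le_trans _ _ (r%:E * (1 - (2 / (p0 * L))%:E))%E); last first.
  by rewrite lee_pmul2l ?lte_fin // leeB.
rewrite -EFinB -EFinM lee_fin mulrBr mulr1 lerD2l lerN2.
(* The loss in Markov's bound is [r * P C]; replacing [r] by [x] cancels [L] and leaves the constant
   [(kap * p0)^-1]. *)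
have rx : r <= x by rewrite le_ln1Dx // (lt_trans _ x0) // ltrN10.
apply: (@le_trans _ _ (x * (2 / (p0 * L)))).
  by rewrite ler_wpM2r // divr_ge0 // ltW // mulr_gt0.
rewrite le_eqVlt; apply/orP; left; apply/eqP.
by rewrite /x; field; rewrite !gt_eqF.
Qed.

End lower_bound.

Lemma mean_capacity_equiv (lam kap p0 : R) : 0 < lam -> 0 < kap -> 0 < p0 ->
  (forall i x, 0 <= x -> (ccdf (gam i) x <= (expR (- (lam * x)))%:E)%E) ->
  (forall i x, 0 < x -> ((p0 * expR (- (kap * x)))%:E <= ccdf (gam i) x)%E) ->
  independent_RVs gam ->
  (forall N, (0 < N)%N -> mean_capacity gam N \is a fin_num) /\
  (fun N => fine (mean_capacity gam N) : R^o)
    ~_\oo (fun N : nat => ln (ln N%:R) : R^o).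
Proof.
move=> lam0 kap0 p00 tail_le tail_ge indep.
have fin N : (0 < N)%N -> mean_capacity gam N \is a fin_num.
  move=> N0; rewrite ge0_fin_numE ?mean_capacity_ge0 //.
  exact: le_lt_trans (mean_capacity_le lam0 tail_le N0) (ltry _).
split => //.
(* For [l >= 1], [1 + l / c] lies between [c^-1 * l] and [(1 + c^-1) * l]. *)
have bnd (c l : R) : 0 < c -> 1 <= l ->
    `|ln (1 + l / c) - ln l| <= `|ln c^-1| + `|ln (1 + c^-1)|.
  move=> c0 l1; apply: dist_ln_le; rewrite ?invr_gt0 ?(lt_le_trans _ l1) //.
  by rewrite mulrC mulrDl mul1r (mulrC _ l) lerD2r l1 lerDr ler01.
pose K (c : R) := `|ln c^-1| + `|ln (1 + c^-1)|.
apply: (@equiv_lnln _ _ (K lam + K (2 * kap) + lam^-1 + (kap * p0)^-1)).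
near=> N.
have N0 : (0 < N)%N by near: N; exact: nbhs_infty_gt.
have l1 : 1 <= ln N%:R :> R by near: N; exact: near_ln_natr_ge.
have := mean_capacity_le lam0 tail_le N0.
have := mean_capacity_ge kap0 p00 tail_ge indep N0 l1.
rewrite -[mean_capacity _ _](fineK (fin _ N0)) !lee_fin => h1 h2.
have k20 : 0 < 2 * kap by rewrite mulr_gt0.
have := bnd _ _ lam0 l1; have := bnd _ _ k20 l1.
rewrite -/(K _) -/(K _) !ler_norml => /andP[h3 h4] /andP[h5 h6].
have : 0 <= lam^-1 by rewrite invr_ge0 ltW.
have : 0 <= (kap * p0)^-1 by rewrite invr_ge0 ltW // mulr_gt0.
have K0 c : 0 <= K c by rewrite addr_ge0.
have := K0 lam; have := K0 (2 * kap).
by move=> *; apply/andP; split; lra.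
Unshelve. all: by end_near. Qed.

End max_rate.

(** * Tails of the SINR *)

Section exponential_RV.
Context d (T : measurableType d) (R : realType) (P : probability T R).
Variables (m : R) (X : {RV P >-> R}).
Hypotheses (m_gt0 : 0 < m) (X_exp : exponential_RV m X).

Lemma exponential_RV_lt0 : P (X @^-1` `]-oo, 0[) = 0%E.
Proof.
rewrite -[LHS]/(distribution P X _) X_exp // /exponential_prob.
apply: integral0_eq => x /=; rewrite in_itv/= => x0.
by rewrite lt0_exponential_pdf.
Qed.

(** The endpoint 0 carries no mass; excluding it keeps the gain [h] positive when it is a
    divisor. *)
Lemma exponential_RV_itvoc (x : R) : 0 < x ->
  P (X @^-1` `]0, x]) = (1 - expR (- (m^-1 * x)))%:E.
Proof.
move=> x0; rewrite -[LHS]/(distribution P X _) X_exp // /exponential_prob.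
rewrite integral_itv_obnd_cbnd; last first.
  apply/measurable_EFinP; apply: measurable_funTS.
  exact: measurable_exponential_pdf.
by rewrite -/(exponential_prob _ _) exponential_prob_itv0c // mulNr.
Qed.

Lemma exponential_RV_gt (x : R) : 0 < x ->
  P (X @^-1` `]x, +oo[) = (expR (- (m^-1 * x)))%:E.
Proof.
move=> x0; have -> : X @^-1` `]x, +oo[ = ~` (X @^-1` `]-oo, x]).
  by apply/seteqP; split => w /=; rewrite !in_itv/= andbT ltNge => /negP.
rewrite probability_setC; last exact: measurable_funPTI.
have -> : X @^-1` `]-oo, x] = X @^-1` `]-oo, 0[ `|` X @^-1` `[0, x].
  by rewrite -preimage_setU -itv_bndbnd_setU // bnd_simp ltW.
have -> : P (X @^-1` `]-oo, 0[ `|` X @^-1` `[0, x]) = P (X @^-1` `[0, x]).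
  rewrite setUC; apply: measureU0; [exact: measurable_funPTI..|].
  exact: exponential_RV_lt0.
rewrite -[P (X @^-1` _)]/(distribution P X _) X_exp //.
by rewrite exponential_prob_itv0c // mulNr -(EFinB 1 (expR _)) -(EFinB 1) opprB addrC subrK.
Qed.

End exponential_RV.

(** The inverse is continuous on the open set of nonzero reals; the point 0, where its value is 0 by
    convention, is treated apart. *)
Lemma measurable_invr (R : realType) :
  measurable_fun [set: R] (fun x : R => x^-1).
Proof.
have -> : (fun x : R => x^-1) = (fun x : R => if x == 0 then 0 else x^-1).
  by apply/funext => x; case: eqVneq => // ->; rewrite invr0.
apply: measurable_fun_if => //; first exact: measurable_fun_eqr.
have -> : [set: R] `&` (fun x : R => x == 0) @^-1` [set false] =
    [set x | x != 0].
  by rewrite setTI; apply/seteqP; split => x /=; case: eqP.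
have o0 : open [set x : R | x != 0] by exact: open_neq.
apply: subspace_continuous_measurable_fun; first exact: open_measurable.
by rewrite continuous_open_subspace // => x; rewrite inE /=; exact: inv_continuous.
Qed.

Section sinr.
Context d (T : measurableType d) (R : realType) (P : probability T R).
Variables (S : system R) (g h q : {RV P >-> R}).
Hypotheses (g_exp : exponential_RV (gbar S) g)
  (h_exp : exponential_RV (hbar S) h) (q_exp : exponential_RV (qbar S) q).

Let pos := (Q_gt0 S, Pmax_gt0 S, Pp_gt0 S, sigma2_gt0 S, gbar_gt0 S,
  hbar_gt0 S, qbar_gt0 S).

Let gamma w := sinr S (g w) (h w) (q w).

Lemma measurable_sinr : measurable_fun [set: T] gamma.
Proof.
have mZ : measurable_fun [set: T] (fun w => Pp S * q w + sigma2 S).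
  by apply: measurable_funD => //; exact: measurable_funM.
have minv (f : T -> R) : measurable_fun [set: T] f ->
    measurable_fun [set: T] (fun w => (f w)^-1).
  by move=> mf; exact: (measurableT_comp (@measurable_invr R) mf).
apply: measurable_minr; apply: measurable_funM.
- exact: measurable_funM.
- by apply: minv; exact: measurable_funM.
- exact: measurable_funM.
- exact: minv.
Qed.

Let measurable_le_gamma x : measurable [set w | gamma w <= x].
Proof.
have -> : [set w | gamma w <= x] = gamma @^-1` `]-oo, x].
  by apply/seteqP; split => w /=; rewrite in_itv.
by rewrite -[X in measurable X]setTI; exact: measurable_sinr.
Qed.

Let measurable_gt_gamma x : measurable [set w | x < gamma w].
Proof.
have -> : [set w | x < gamma w] = gamma @^-1` `]x, +oo[.
  by apply/seteqP; split => w /=; rewrite in_itv /= andbT.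
by rewrite -[X in measurable X]setTI; exact: measurable_sinr.
Qed.

Lemma F_gamma_ccdf x : (1 - F_gamma S g h q x)%E = P [set w | x < gamma w].
Proof.
rewrite /F_gamma -probability_setC //; congr (P _).
by apply/seteqP; split => w /=; rewrite ltNge => /negP.
Qed.

(** Outside the null event that some gain is negative, both quotients are nonnegative, even for
    [h w = 0], where division gives 0. *)
Lemma F_gamma_lt0 x : x < 0 -> F_gamma S g h q x = 0%E.
Proof.
move=> x0; apply: measure_negligible => //.
pose N (X : {RV P >-> R}) := X @^-1` `]-oo, 0[.
have negl X m : 0 < m -> exponential_RV m X -> P.-negligible (N X).
  move=> m0 /exponential_RV_lt0 X0; apply/negligibleP => //.
  exact: measurable_funPTI.
apply: (negligibleS (A := N g `|` N h `|` N q)); last first.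
  apply: negligibleU; last exact: negl (qbar_gt0 S) q_exp.
  apply: negligibleU; first exact: negl (gbar_gt0 S) g_exp.
  exact: negl (hbar_gt0 S) h_exp.
move=> w /= ; rewrite /N /= !in_itv/= => gx.
have [g0|] := ltP (g w) 0; first by left; left.
have [h0|] := ltP (h w) 0; first by left; right.
have [q0|] := ltP (q w) 0; first by right.
move=> q0 h0 g0; move: gx; rewrite leNgt (lt_le_trans x0) //.
have Z0 : 0 <= Pp S * q w + sigma2 S.
  by rewrite addr_ge0 ?mulr_ge0 // ltW // ?pos.
by rewrite /gamma /sinr le_min !divr_ge0 ?mulr_ge0 // ltW ?pos.
Qed.

Lemma F_gamma_tail_le x : 0 <= x ->
  (1 - F_gamma S g h q x <=
   (expR (- (sigma2 S / (Pmax S * gbar S) * x)))%:E)%E.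
Proof.
rewrite F_gamma_ccdf le_eqVlt => /predU1P[<-|x0].
  by rewrite mulr0 oppr0 expR0; exact: probability_le1.
pose y := x * sigma2 S / Pmax S.
have y0 : 0 < y by rewrite divr_gt0 ?mulr_gt0 ?pos.
have mg : measurable (g @^-1` `]y, +oo[) by exact: measurable_funPTI.
have mq : measurable (q @^-1` `]-oo, 0[) by exact: measurable_funPTI.
(* When [q >= 0] the power-capped term of the minimum is at most [Pmax * g / sigma2], so [gamma > x]
   forces [g > y]; the event [q < 0] is null. *)
apply: (@le_trans _ _ (P (g @^-1` `]y, +oo[ `|` q @^-1` `]-oo, 0[))).
  apply: le_probability => //; first exact: measurableU.
  move=> w /=; rewrite !in_itv/= andbT => xg.
  have [|q0] := ltP (q w) 0; [by right|left].
  have Z0 : 0 < Pp S * q w + sigma2 S.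
    by rewrite ltr_wpDl ?mulr_ge0 // ?pos // ltW // pos.
  move: xg; rewrite /gamma /sinr lt_min => /andP[_]; rewrite ltr_pdivlMr //.
  rewrite /y ltr_pdivrMr ?pos // (mulrC (g w)); apply: le_lt_trans.
  by rewrite ler_wpM2l ?(ltW x0) // lerDr mulr_ge0 // ltW ?pos.
rewrite measureU0 //; last exact: exponential_RV_lt0 q_exp.
have -> : sigma2 S / (Pmax S * gbar S) * x = (gbar S)^-1 * y.
  by rewrite /y; field; rewrite !gt_eqF ?pos.
by rewrite -(exponential_RV_gt g_exp y0).
Qed.

Hypothesis ghq_indep : independent_RVs (fun i : 'I_3 => tnth [tuple g; h; q] i).

Lemma ghq_indep3 (A B C : set R) : measurable A -> measurable B -> measurable C ->
  P (g @^-1` A `&` (h @^-1` B `&` q @^-1` C)) =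
  (P (g @^-1` A) * (P (h @^-1` B) * P (q @^-1` C)))%E.
Proof.
move=> mA mB mC.
pose D (i : 'I_3) := tnth [tuple A; B; C] i.
have mD i : measurable (D i).
  by case: i => -[|[|[|//]]] i3; rewrite /D (tnth_nth set0).
pose i0 : 'I_3 := ord0; pose i1 : 'I_3 := Ordinal (isT : 1 < 3)%N.
pose i2 : 'I_3 := Ordinal (isT : 2 < 3)%N.
have := ghq_indep (s := [:: i0; i1; i2]) isT mD.
rewrite !big_cons big_nil mule1 /D !(tnth_nth set0) !(tnth_nth g) /= => <-.
congr (P _); apply/seteqP; split => w /=.
  by move=> [Aw [Bw Cw]] i /=; rewrite !inE => /or3P[] /eqP ->;
    rewrite (tnth_nth set0) (tnth_nth g).
move=> ABC; split; [|split].
- by have := ABC i0; rewrite /= (tnth_nth set0) (tnth_nth g); apply; rewrite !inE.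
- by have := ABC i1; rewrite /= (tnth_nth set0) (tnth_nth g); apply; rewrite !inE.
- by have := ABC i2; rewrite /= (tnth_nth set0) (tnth_nth g); apply; rewrite !inE.
Qed.

Lemma F_gamma_tail_ge : exists kap p0 : R, [/\ 0 < kap, 0 < p0 &
  forall x, 0 < x -> ((p0 * expR (- (kap * x)))%:E <= 1 - F_gamma S g h q x)%E].
Proof.
(* Where h <= Q / Pmax the power cap Pmax is the binding constraint, and where
   q <= qbar the interference is bounded; both events have fixed positive
   probability and are independent of g. *)
pose p (u : R) := 1 - expR (- u).
have p_gt0 u : 0 < u -> 0 < p u.
  by move=> u0; rewrite /p subr_gt0 -[ltRHS]expR0 ltr_expR oppr_lt0.
pose H := Q S / Pmax S; pose Z := Pp S * qbar S + sigma2 S.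
have H0 : 0 < H by rewrite divr_gt0 ?pos.
have Z0 : 0 < Z by rewrite addr_gt0 ?mulr_gt0 ?pos.
(* [p0] is the probability of [0 < h <= H] times that of [0 < q <= qbar]; [kap] is the decay rate in
   [x] of the event [g > Z / Pmax * x]. *)
exists ((gbar S)^-1 * (Z / Pmax S)),
  (p ((hbar S)^-1 * H) * p ((qbar S)^-1 * qbar S)).
split.
- by rewrite !mulr_gt0 ?invr_gt0 ?pos.
- by rewrite mulr_gt0 // p_gt0 // mulr_gt0 ?invr_gt0 ?pos.
move=> x x0; pose y := Z / Pmax S * x.
have y0 : 0 < y by rewrite mulr_gt0 // divr_gt0 ?pos.
rewrite F_gamma_ccdf.
apply: (@le_trans _ _ (P (g @^-1` `]y, +oo[ `&`
    (h @^-1` `]0, H] `&` q @^-1` `]0, qbar S])))).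
  rewrite ghq_indep3 // (exponential_RV_gt g_exp) //.
  rewrite (exponential_RV_itvoc h_exp) // (exponential_RV_itvoc q_exp) ?pos //.
  by rewrite -!EFinM lee_fin -/(p _) -/(p _) (mulrC (expR _)) /y !mulrA.
apply: le_probability => //.
  by apply: measurableI; [|apply: measurableI]; exact: measurable_funPTI.
move=> w [/=]; rewrite !in_itv/= andbT => yg [/andP[h0 hH] /andP[q0 qq]].
have q1 : 0 < Pp S * q w + sigma2 S by rewrite addr_gt0 ?mulr_gt0 ?pos.
have qZ : Pp S * q w + sigma2 S <= Z by rewrite lerD2r ler_pM2l ?pos.
have xg : x * (Pp S * q w + sigma2 S) < Pmax S * g w.
  apply: (@le_lt_trans _ _ (x * Z)); first by rewrite ler_pM2l.
  by rewrite -ltr_pdivrMl ?pos // mulrCA mulrA mulrAC (_ : _ * _ = y) // /y; ring.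
rewrite /gamma /sinr lt_min !ltr_pdivlMr ?mulr_gt0 // xg andbT.
(* Since [h <= H] and [Q = H * Pmax], the interference-limited term follows from [xg] multiplied by
   [H]. *)
rewrite mulrCA; apply: (@le_lt_trans _ _ (H * (x * (Pp S * q w + sigma2 S)))).
  by rewrite ler_wpM2r // mulr_ge0 // ltW.
rewrite (_ : Q S * g w = H * (Pmax S * g w)) ?ltr_pM2l //.
by rewrite /H mulrA divfK ?gt_eqF ?pos.
Qed.

End sinr.

(** The distribution function measures closed half-lines, so the open one is exhausted by those
    ending at [- n.+1%:R^-1]. *)
Lemma probability_lt0_of_cdf d (T : measurableType d) (R : realType)
    (P : probability T R) (X : {RV P >-> R}) :
  (forall x, x < 0 -> cdf X x = 0%E) -> P (X @^-1` `]-oo, 0[) = 0%E.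
Proof.
move=> X0; apply: measure_negligible; first exact: measurable_funPTI.
apply: (negligibleS (A := \bigcup_n (X @^-1` `]-oo, - n.+1%:R^-1]))).
  move=> w /=; rewrite in_itv/= => /ltr_add_invr[n nX].
  by exists n => //=; rewrite in_itv/= -sub0r lerBrDr ltW.
apply: negligible_bigcup => n; apply/negligibleP; first exact: measurable_funPTI.
by apply: X0; rewrite oppr_lt0.
Qed.

Theorem mainTheorem8 (R : realType) (S : system R)
    (d : measure_display) (T : measurableType d) (P : probability T R)
    (g h q : {RV P >-> R})
    (g_exp : exponential_RV (gbar S) g)
    (h_exp : exponential_RV (hbar S) h)
    (q_exp : exponential_RV (qbar S) q)
    (ghq_indep : independent_RVs (fun i : 'I_3 => tnth [tuple g; h; q] i))
    (d' : measure_display) (T' : measurableType d') (P' : probability T' R)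
    (gam : nat -> {RV P' >-> R})
    (gam_cdf : forall (i : nat) (x : R), cdf (gam i) x = F_gamma S g h q x)
    (gam_indep : independent_RVs gam) :
  [/\ (* the logarithms defining a_N and b_N make sense for all large N *)
      \forall N \near \oo, 0 < 1 + F_TPLR_inv S (1 - N%:R^-1),
      (* and whenever they do, the outage capacity has the closed form *)
      forall (N : nat) (eps : R), (0 < N)%N -> 0 < eps < 1 ->
        0 < 1 + F_TPLR_inv S (1 - N%:R^-1) ->
        C_out_TPLR S N eps = a_TPLR S N - b_TPLR S N * ln (ln (1 / eps)),
      forall eps : R, 0 < eps < 1 ->
        (fun N : nat => C_out_TPLR S N eps : R^o)
          ~_\oo (fun N : nat => ln (ln N%:R) : R^o),
      (forall N : nat, (0 < N)%N -> mean_capacity gam N \is a fin_num) /\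
      (fun N : nat => fine (mean_capacity gam N) : R^o)
          ~_\oo (fun N : nat => ln (ln N%:R) : R^o)
    & forall eps1 eps2 : R, 0 < eps1 < 1 -> 0 < eps2 < 1 ->
        C_out_TPLR S N eps1 - C_out_TPLR S N eps2 @[N --> \oo] --> (0 : R)].
Proof.
have [kap [p0 [kap0 p00 tail_ge]]] := F_gamma_tail_ge g_exp h_exp q_exp ghq_indep.
split.
- exact: near_F_TPLR_inv_gt0.
- by move=> N eps N0 e01 D0; exact: C_out_TPLRE.
- exact: C_out_TPLR_equiv.
(* Through [gam_cdf] the tail bounds on [F_gamma] hold for every antenna. *)
- apply: (@mean_capacity_equiv _ _ _ _ gam _ (sigma2 S / (Pmax S * gbar S))
    kap p0) => //.
  + apply: probability_lt0_of_cdf => x x0.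
    by rewrite gam_cdf (F_gamma_lt0 g_exp h_exp q_exp).
  + by rewrite divr_gt0 ?mulr_gt0 ?sigma2_gt0 ?Pmax_gt0 ?gbar_gt0.
  + by move=> i x x0; rewrite ccdf_1_cdf gam_cdf; exact: F_gamma_tail_le.
  + by move=> i x x0; rewrite ccdf_1_cdf gam_cdf; exact: tail_ge.
- exact: C_out_TPLR_threshold.
Qed.
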